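(* Let $\Gamma$, the new edge $\mathcal{E}$ and the spine $\mathcal{S}=\Gamma+\mathcal{E}$ be as specified in the context, and assume $h(-p)>\mathrm{ord}(\ell)$. Then $$\frac{h(-p)\,\mathrm{ord}(\ell)+3h(-p)+6\,\mathrm{ord}(\ell)}{2(h(-p)-\mathrm{ord}(\ell))}\ >\ \frac12\left(\mathrm{ord}(\ell)+3-\frac{4\,\mathrm{ord}(\ell)}{h(-p)+\mathrm{ord}(\ell)}\right).$$ If edge attachment occurs (the endpoints of $\mathcal{E}$ lie in different connected components of $\Gamma$), then $\mathrm{MeanDiam}(\mathcal{S})$ is at least the left-hand side; if edge attachment does not occur, then $\mathrm{MeanDiam}(\mathcal{S})$ is at most the right-hand side. Consequently, given $h(-p)$ and $\mathrm{ord}(\ell)$, the value of $\mathrm{MeanDiam}(\mathcal{S})$ determines whether edge attachment occurs.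
   Context: Let $p$ be a prime with $p\equiv 71$ or $119\pmod{120}$ and $\ell=2$. Let $h(-p)$ be the class number of $\mathbb{Q}(\sqrt{-p})$ (it is odd) and let $L=\mathrm{ord}(\ell)$ be the order in the class group of a prime ideal above $2$; $L$ is an odd integer $\ge3$ dividing $h(-p)$. The graph $\Gamma$ (the supersingular $2$-isogeny graph over $\mathbb{F}_p$ after identifying curves and isogenies up to $\overline{\mathbb{F}_p}$-equivalence, regarded as a simple undirected graph) is the disjoint union of one folded component $\mathcal{F}$ and $\frac12\left(\frac{h(-p)}{L}-1\right)$ stacked components, each a copy of $\mathcal{T}$, where $V(\mathcal{F})=\{0,\dots,L-1\}$, $E(\mathcal{F})=\{\{2k-1,2k+1\}: 1\le k\le \tfrac12(L-3)\}\cup\{\{2k+1,2k+2\}:0\le k\le \tfrac12(L-3)\}\cup\{\{0,1\}\}$, and $V(\mathcal{T})=\{0,\dots,2L-1\}$, $E(\mathcal{T})=\{\{2i,2i+1\}:0\le i\le L-1\}\cup\{\{2i+1,2i+3\}:0\le i\le L-2\}\cup\{\{2L-1,1\}\}$. Floor vertices are the nonzero even vertices of $\mathcal{F}$ and all even vertices of the stacked components. The spine $\mathcal{S}$ is obtained from $\Gamma$ by adding a single new edge $\mathcal{E}$ (coming from $2$-isogenies not defined over $\mathbb{F}_p$), whose endpoints are two distinct floor vertices; it is treated here as an arbitrary such edge. For a graph with connected components $C_1,\dots,C_m$, $\mathrm{MeanDiam}$ is $\frac1m\sum_{i=1}^m\mathrm{diam}(C_i)$. *)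

(* Defs.v *)
From mathcomp Require Import all_boot all_order all_algebra all_field.

Set Implicit Arguments.
Unset Strict Implicit.
Unset Printing Implicit Defensive.

Import GRing.Theory Num.Theory.

(** * Class number of Q(sqrt(-p)) and order of an ideal class

    Q(sqrt(-p)) is realised inside [algC]; ideals of its ring of integers are
    sets of algebraic numbers, and two ideals are equal when they have the same
    elements. *)

Section IdealClasses.
Local Open Scope ring_scope.

Definition quadratic_field (p : nat) (z : algC) : Prop :=
  exists a b : rat, z = ratr a + ratr b * sqrtC (- p%:R).

Definition integers (p : nat) (z : algC) : Prop :=
  quadratic_field p z /\ z \in Aint.

Definition nonzero_ideal (p : nat) (I : algC -> Prop) : Prop :=
  [/\ forall x, I x -> integers p x,
      forall x y, I x -> I y -> I (x + y),
      forall a x, integers p a -> I x -> I (a * x)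
    & exists2 x, I x & x != 0].

Definition prime_ideal (p : nat) (I : algC -> Prop) : Prop :=
  [/\ nonzero_ideal p I,
      ~ I 1
    & forall x y, integers p x -> integers p y -> I (x * y) -> I x \/ I y].

(* Equality of classes in the class group: a I = b J for some nonzero integers
   a and b of the field. *)
Definition same_class (p : nat) (I J : algC -> Prop) : Prop :=
  exists a b : algC,
    [/\ integers p a /\ a != 0,
        integers p b /\ b != 0
      & forall z, (exists2 x, I x & z = a * x) <-> (exists2 y, J y & z = b * y)].

Definition class_number (p h : nat) : Prop :=
  exists c : 'I_h -> algC -> Prop,
    [/\ forall i, nonzero_ideal p (c i),
        forall i j, same_class p (c i) (c j) -> i = j
      & forall I, nonzero_ideal p I -> exists i, same_class p I (c i)].

Definition ideal_mul (I J : algC -> Prop) (z : algC) : Prop :=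
  exists2 s : seq (algC * algC),
    forall q, q \in s -> I q.1 /\ J q.2 & z = \sum_(q <- s) q.1 * q.2.

Definition ideal_exp (p : nat) (I : algC -> Prop) (n : nat) : algC -> Prop :=
  iter n (ideal_mul I) (integers p).

(* [integers p], the unit ideal, represents the identity of the class group. *)
Definition class_order (p : nat) (I : algC -> Prop) (n : nat) : Prop :=
  [/\ (0 < n)%N,
      same_class p (ideal_exp p I n) (integers p)
    & forall m, (0 < m < n)%N ->
        ~ same_class p (ideal_exp p I m) (integers p)].

End IdealClasses.

(** * Distance and mean diameter of a finite graph *)

Section Graphs.
Variables (V : finType) (e : rel V).

Definition walk (k : nat) (x y : V) : bool :=
  [exists s : k.-tuple V, path e x s && (last x s == y)].

(* The least length of a walk from x to y; a shortest walk visits each vertex at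
   most once, so lengths below #|V| suffice.  The value is #|V| if x and y are
   not connected. *)
Definition dist (x y : V) : nat := find (fun k => walk k x y) (iota 0 #|V|).

Definition components : {set {set V}} :=
  equivalence_partition (connect e) [set: V].

(* Shortest walks between vertices of a component stay in that component, so
   this is the diameter of the component as a graph of its own. *)
Definition diam (C : {set V}) : nat :=
  \max_(x in C) \max_(y in C) dist x y.

Definition mean_diam : rat :=
  ((\sum_(C in components) (diam C)%:R) / #|components|%:R)%R.

End Graphs.

(** * The graph Gamma and the spine

    Each edge set is listed with one orientation of every edge and then
    symmetrised. *)

Definition symmetrise (V : Type) (r : rel V) : rel V :=
  fun x y => r x y || r y x.

Definition folded_arc (L : nat) : rel 'I_L := fun x y =>
  [|| [exists k : 'I_L, [&& 1 <= k <= (L - 3)./2,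
                            val x == 2 * k - 1 & val y == 2 * k + 1]],
      [exists k : 'I_L, [&& k <= (L - 3)./2,
                            val x == 2 * k + 1 & val y == 2 * k + 2]]
    | (val x == 0) && (val y == 1)].

Definition folded (L : nat) : rel 'I_L := symmetrise (@folded_arc L).

Definition stacked_arc (L : nat) : rel 'I_(2 * L) := fun x y =>
  [|| [exists i : 'I_L, (val x == 2 * i) && (val y == 2 * i + 1)],
      [exists i : 'I_L, [&& i <= L - 2,
                            val x == 2 * i + 1 & val y == 2 * i + 3]]
    | (val x == 2 * L - 1) && (val y == 1)].

Definition stacked (L : nat) : rel 'I_(2 * L) := symmetrise (@stacked_arc L).

Definition num_stacked (h L : nat) : nat := (h %/ L - 1)./2.

Definition Gamma_vertex (h L : nat) : finType :=
  ('I_L + 'I_(num_stacked h L) * 'I_(2 * L))%type.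

Definition Gamma (h L : nat) : rel (Gamma_vertex h L) := fun x y =>
  match x, y with
  | inl i, inl j => folded i j
  | inr (c, i), inr (d, j) => (c == d) && stacked i j
  | _, _ => false
  end.

Definition floor_vertex (h L : nat) (x : Gamma_vertex h L) : bool :=
  match x with
  | inl i => (val i != 0) && ~~ odd i
  | inr (_, i) => ~~ odd i
  end.

(* The admissible endpoints of the new edge. *)
Definition floor_pair (h L : nat) (u v : Gamma_vertex h L) : bool :=
  [&& floor_vertex u, floor_vertex v & u != v].

Definition spine (h L : nat) (u v : Gamma_vertex h L) :
    rel (Gamma_vertex h L) := fun x y =>
  Gamma x y || symmetrise (fun a b => (a == u) && (b == v)) x y.

Definition edge_attachment (h L : nat) (u v : Gamma_vertex h L) : bool :=
  ~~ connect (@Gamma h L) u v.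

(* Main.v *)
Require Import Defs.
From mathcomp Require Import all_boot all_order all_algebra all_field.
From mathcomp Require Import zify ring lra.

Set Implicit Arguments.
Unset Strict Implicit.
Unset Printing Implicit Defensive.

Import Order.TTheory GRing.Theory Num.Theory.

(** Write [L = 2m + 1] and [h = L(2s + 1)], so that Gamma has [s] stacked
    components, of diameter [m + 2], and a folded one, of diameter [m + 1].
    An edge inside a component cannot increase its diameter, which gives the
    upper bound [(s(m + 2) + m + 1)/(s + 1)], the right-hand side.  An edge
    [u v] between two components merges them into one of diameter at least
    [ecc u + 1 + ecc v]; a floor vertex has eccentricity [m + 2] in a stacked
    component and at least [(m + 3)/2] in the folded one, so the worst case is
    an attachment to the folded component, where the mean is at least the
    left-hand side.  The value [m + 2] separates the two sides.

    Distances are bounded below by 1-Lipschitz functions on the vertices. *)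

(** * Walks, distances and diameters in a finite graph *)

Section GraphDistance.
Variables (V : finType) (e : rel V).

(** Bounding the length instead of fixing it lets upper bounds on distances be added and weakened
    freely. *)
Definition within (k : nat) (x y : V) : Prop :=
  exists s, [/\ path e x s, last x s = y & size s <= k].

Definition lipschitz (f : V -> nat) : Prop :=
  forall x y, e x y -> f y <= (f x).+1.

Lemma within0 k x : within k x x.
Proof. by exists [::]. Qed.

Lemma within1 x y : e x y -> within 1 x y.
Proof. by move=> exy; exists [:: y]; rewrite /= exy. Qed.

Lemma within_leq k l x y : k <= l -> within k x y -> within l x y.
Proof. by move=> le_kl [s [p <- /leq_trans]] => /(_ _ le_kl); exists s. Qed.

Lemma within_trans k l x y z : within k x y -> within l y z -> within (k + l) x z.
Proof.
move=> [s [ps <- sk]] [t [pt <- tl]]; exists (s ++ t).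
by rewrite cat_path last_cat ps pt size_cat leq_add.
Qed.

Lemma within_sym k x y : symmetric e -> within k x y -> within k y x.
Proof.
move=> sym_e [s [ps <- sk]]; exists (rev (belast x s)).
rewrite size_rev size_belast sk; split=> //.
  by rewrite rev_path (@eq_path _ _ e) // => a b; rewrite sym_e.
by case: s {ps sk} => //= a s; rewrite rev_cons last_rcons.
Qed.

Lemma within_connect k x y : within k x y -> connect e x y.
Proof. by move=> [s [ps <- _]]; apply/connectP; exists s. Qed.

Lemma walkP k x y :
  reflect (exists s, [/\ path e x s, last x s = y & size s = k]) (walk e k x y).
Proof.
apply: (iffP existsP) => [[s /andP[ps /eqP ls]]|[s [ps ls /eqP sk]]].
  by exists s; rewrite size_tuple.
by exists (Tuple sk); rewrite /= ps ls eqxx.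
Qed.

Lemma within_dist k x y : within k x y -> dist e x y <= k.
Proof.
move=> [s [ps <- sk]]; apply: leq_trans sk; rewrite /dist.
(* A walk of length at least [#|V|] needs no further argument, since [find] never exceeds the length
   of its list. *)
set a := fun k => _; case: (ltnP (size s) #|V|) => [sV|]; last first.
  by apply: leq_trans; rewrite -[leqRHS](size_iota 0) find_size.
rewrite leqNgt; apply/negP => /(before_find 0); rewrite nth_iota //.
by move/negbT/negP; apply; rewrite /a add0n; apply/walkP; exists s.
Qed.

(** Along a walk of length [dist e x y] the function gains at most one per step. Connectedness makes
    the [find] in [dist] succeed: a walk without repeated vertices has length below [#|V|]. *)
Lemma lipschitz_dist f x y :
  lipschitz f -> connect e x y -> f y <= f x + dist e x y.
Proof.
move=> lip_f /connectP[p0 + ->] => /shortenP[p ep up _].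
have : has (fun k => walk e k x (last x p)) (iota 0 #|V|).
  apply/hasP; exists (size p); last by apply/walkP; exists p.
  have /card_uniqP up' := up.
  by rewrite mem_iota add0n -[(size p).+1]/(size (x :: p)) -up' max_card.
move=> hw; have := nth_find 0 hw; move: hw; rewrite has_find size_iota => hw.
rewrite nth_iota // add0n => /walkP[s [ps <- sz]].
rewrite [dist _ _ _]/dist -[X in _ <= _ + X]sz.
elim: s x {p0 p ep up hw sz} ps => [|z s IH] x /=; first by rewrite addn0.
by case/andP=> /lip_f + /IH; lia.
Qed.

Lemma diam_geq (C : {set V}) x y :
  x \in C -> y \in C -> dist e x y <= diam e C.
Proof.
by move=> xC yC; apply: (bigop.bigmax_sup x) => //; apply: (bigop.bigmax_sup y).
Qed.

Lemma diam_leq (C : {set V}) k :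
  {in C &, forall x y, within k x y} -> diam e C <= k.
Proof.
move=> Ck; apply/bigmax_leqP => x xC; apply/bigmax_leqP => y yC.
exact/within_dist/Ck.
Qed.

Lemma lipschitz_diam f (C : {set V}) x y :
  lipschitz f -> connect e x y -> x \in C -> y \in C -> f y <= f x + diam e C.
Proof.
move=> lf cxy xC yC; apply: leq_trans (lipschitz_dist lf cxy) _.
by rewrite leq_add2l diam_geq.
Qed.

(** The fibres of [lab] are exactly the components, so the sum over a set of sets becomes a sum over
    label values. *)
Lemma mean_diam_label (I : finType) (lab : V -> I) :
  (forall x y, connect e x y = (lab x == lab y)) ->
  (mean_diam e = (\sum_(c in lab @: setT) diam e [set x | lab x == c])%N%:R
                  / #|lab @: setT|%:R)%R.
Proof.
move=> labE.
have compE : components e = [set [set x | lab x == c] | c in lab @: setT].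
  rewrite -imset_comp; apply: eq_imset => x /=; apply/setP=> y.
  by rewrite !inE labE eq_sym.
have inj : {in lab @: setT &, injective (fun c => [set x | lab x == c])}.
  move=> _ _ /imsetP[x _ ->] /imsetP[y _ ->] /setP/(_ x).
  by rewrite !inE eqxx => /esym/eqP.
by rewrite /mean_diam compE big_imset //= (card_in_imset inj) natr_sum.
Qed.

End GraphDistance.

Lemma within_homo (V W : finType) (e : rel V) (e' : rel W) (g : V -> W) k x y :
  {homo g : a b / e a b >-> e' a b} -> within e k x y -> within e' k (g x) (g y).
Proof.
move=> hg [s [ps <- sk]]; exists (map g s).
by rewrite last_map size_map (homo_path _ ps).
Qed.

Lemma eq_mean_diam (V : finType) (e e' : rel V) :
  e =2 e' -> mean_diam e = mean_diam e'.
Proof.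
move=> ee'; have wE k x y : walk e k x y = walk e' k x y.
  by apply: eq_existsb => s; rewrite (eq_path ee').
have dE C : diam e C = diam e' C.
  apply: eq_bigr => x _; apply: eq_bigr => y _.
  by apply: eq_find => k; apply: wE.
have cE : components e = components e'.
  by apply: eq_imset => x; apply/setP=> y; rewrite !inE (eq_connect ee').
by rewrite /mean_diam cE; under eq_bigr do rewrite dE.
Qed.

Lemma symmetrise_sym (V : Type) (r : rel V) : symmetric (symmetrise r).
Proof. by move=> x y; rewrite /symmetrise orbC. Qed.

(** * Arcs and upper bounds for distances in the folded and stacked components *)

Section FoldedStacked.
Variable L : nat.
Hypotheses (L_odd : odd L) (L_ge3 : 3 <= L).

(** The index [k] is determined by [x], and its range follows from [y < L] with [L] odd. *)
Lemma folded_arcE (x y : 'I_L) :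
  folded_arc x y = [|| odd x && (y == x.+2 :> nat), odd x && (y == x.+1 :> nat)
                     | (x == 0 :> nat) && (y == 1 :> nat)].
Proof.
have xL := ltn_ord x; have yL := ltn_ord y; rewrite /folded_arc /=.
congr [|| _, _ | _].
  apply/existsP/andP => [[k]|[xo /eqP yx]]; first by move=> *; split; lia.
  have kL : x.+1./2 < L by lia.
  by exists (Ordinal kL) => /=; lia.
apply/existsP/andP => [[k]|[xo /eqP yx]]; first by move=> *; split; lia.
have kL : x./2 < L by lia.
by exists (Ordinal kL) => /=; lia.
Qed.

Lemma stacked_arcE (x y : 'I_(2 * L)) :
  stacked_arc x y = [|| ~~ odd x && (y == x.+1 :> nat),
                        odd x && (y == x.+2 :> nat)
                      | (x == (2 * L).-1 :> nat) && (y == 1 :> nat)].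
Proof.
have xL := ltn_ord x; have yL := ltn_ord y; rewrite /stacked_arc /= subn1.
congr [|| _, _ | _].
  apply/existsP/andP => [[k]|[xo /eqP yx]]; first by move=> *; split; lia.
  have kL : x./2 < L by lia.
  by exists (Ordinal kL) => /=; lia.
apply/existsP/andP => [[k]|[xo /eqP yx]]; first by move=> *; split; lia.
have kL : x./2 < L by lia.
by exists (Ordinal kL) => /=; lia.
Qed.

(** The backbone is the path 0, 1, 3, 5, ..., on which [uphalf] gives the positions 0, 1, 2, 3, ...;
    the walk climbs one position at a time. *)
Lemma folded_path n (x y : 'I_L) :
  odd x || (x == 0 :> nat) -> odd y || (y == 0 :> nat) ->
  uphalf y = uphalf x + n -> within (@folded L) n x y.
Proof.
elim: n x => [|n IH] x xo yo yx.
  have -> : x = y by apply: ord_inj; lia.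
  exact: within0.
have yL := ltn_ord y.
have zL : (if x == 0 :> nat then 1 else x.+2) < L by case: eqP; lia.
pose z := Ordinal zL.
rewrite -[n.+1]add1n; apply: (@within_trans _ _ _ _ _ z).
  apply: within1; rewrite /folded /symmetrise !folded_arcE /z /=.
  by case: ifP => ?; lia.
by apply: IH => //=; case: ifP => ?; lia.
Qed.

Lemma folded_hook (x : 'I_L) : ~~ odd x -> x != 0 :> nat ->
  exists z : 'I_L, [/\ odd z, uphalf z = uphalf x & folded x z].
Proof.
move=> xe x0; have xL := ltn_ord x; have zL : x.-1 < L by lia.
exists (Ordinal zL); rewrite /folded /symmetrise !folded_arcE /=.
by split; lia.
Qed.

Lemma folded_backbone_within (x y : 'I_L) :
  odd x || (x == 0 :> nat) -> odd y || (y == 0 :> nat) ->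
  within (@folded L) ((uphalf y - uphalf x) + (uphalf x - uphalf y)) x y.
Proof.
move=> xo yo; case: (leqP (uphalf x) (uphalf y)) => xy.
  by apply: folded_path => //; lia.
by apply: within_sym; [apply: symmetrise_sym|apply: folded_path => //; lia].
Qed.

(** Backbone positions run from 0 to [L./2]. A hanging vertex costs one extra step but has position
    at least 1, so two of them are at most [(L./2 - 1) + 2] apart. *)
Lemma folded_within (x y : 'I_L) : within (@folded L) L./2.+1 x y.
Proof.
have xL := ltn_ord x; have yL := ltn_ord y.
have fsym := @symmetrise_sym _ (@folded_arc L).
case xo: (odd x || (x == 0 :> nat)); case yo: (odd y || (y == 0 :> nat)).
- by apply: within_leq (folded_backbone_within xo yo); lia.
- have [||z [zo zy yz]] := @folded_hook y; [by lia..|].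
  have xz := folded_backbone_within xo (introT orP (or_introl zo)).
  apply: within_leq (within_trans xz (within_sym fsym (within1 yz))).
  by lia.
- have [||z [zo zx xz]] := @folded_hook x; [by lia..|].
  have zy := folded_backbone_within (introT orP (or_introl zo)) yo.
  by apply: within_leq (within_trans (within1 xz) zy); lia.
have [||z [zo zx xz]] := @folded_hook x; [by lia..|].
have [||t [to ty yt]] := @folded_hook y; [by lia..|].
have zt := folded_backbone_within (introT orP (or_introl zo))
                               (introT orP (or_introl to)).
apply: within_leq (within_trans (within1 xz)
  (within_trans zt (within_sym fsym (within1 yt)))).
by lia.
Qed.

(** The odd vertices form a cycle of length [L] with positions [x./2]; the second alternative is a
    walk passing from [2 * L - 1] to 1. *)
Lemma stacked_cycle n (x y : 'I_(2 * L)) : odd x -> odd y ->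
  y./2 = x./2 + n \/ y./2 + L = x./2 + n -> within (@stacked L) n x y.
Proof.
elim: n x => [|n IH] x xo yo yx; have yL := ltn_ord y; have xL := ltn_ord x.
  have -> : x = y by apply: ord_inj; lia.
  exact: within0.
have zL : (if x.+1 == 2 * L then 1 else x.+2) < 2 * L by case: eqP; lia.
pose z := Ordinal zL.
rewrite -[n.+1]add1n; apply: (@within_trans _ _ _ _ _ z).
  apply: within1; rewrite /stacked /symmetrise !stacked_arcE /z /=.
  by case: ifP => ?; lia.
by apply: IH => //=; case: ifP => ?; lia.
Qed.

Lemma stacked_cycle_within (x y : 'I_(2 * L)) :
  odd x -> odd y -> within (@stacked L) L./2 x y.
Proof.
move=> xo yo; have xL := ltn_ord x; have yL := ltn_ord y.
have ssym := @symmetrise_sym _ (@stacked_arc L).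
(* The forward arc from [x] to [y] has length [n], the one from [y] to [x] has length [L - n]; one
   of them is at most [L./2]. *)
pose n := if x <= y then y./2 - x./2 else y./2 + L - x./2.
case: (leqP n L./2) => nL.
  apply: (within_leq nL); apply: stacked_cycle => //.
  by rewrite /n; case: ifP; lia.
apply: (@within_leq _ _ (L - n)); first by lia.
apply: (within_sym ssym); apply: stacked_cycle => //.
by move: nL; rewrite /n; case: ifP; lia.
Qed.

Lemma stacked_hook (x : 'I_(2 * L)) :
  exists2 z : 'I_(2 * L), odd z & within (@stacked L) 1 x z.
Proof.
case xo: (odd x); first by exists x => //; apply: within0.
have xL := ltn_ord x; have zL : x.+1 < 2 * L by lia.
exists (Ordinal zL); first by rewrite /= xo.
apply: within1; rewrite /stacked /symmetrise !stacked_arcE /=.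
by lia.
Qed.

Lemma stacked_within (x y : 'I_(2 * L)) : within (@stacked L) L./2.+2 x y.
Proof.
have ssym := @symmetrise_sym _ (@stacked_arc L).
have [z zo xz] := stacked_hook x; have [t to yt] := stacked_hook y.
have := within_trans (within_trans xz (stacked_cycle_within zo to))
  (within_sym ssym yt).
by apply: within_leq; lia.
Qed.

(** * Potentials giving lower bounds for distances *)

Definition line_dist (i j : nat) : nat := (i - j) + (j - i).

Lemma line_distxx i : line_dist i i = 0.
Proof. by rewrite /line_dist subnn. Qed.

(* In both components the odd vertices carry a path or a cycle, on which x sits at
   or hangs from position [uphalf x] in the folded case and [x./2] in the stacked
   one; the vertex 0 of the folded component is position 0 of the path. *)
Definition folded_pot (w x : nat) : nat :=
  if x == w then 0 else
  (line_dist (uphalf w) (uphalf x)).+1 + (~~ odd x && (x != 0)).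

Definition cycle_dist (i j : nat) : nat :=
  minn (line_dist i j) (L - line_dist i j).

(** Meant for even [w]: the successor counts the step from [w] to the cycle, the last summand the
    step from the cycle to an even [x]. *)
Definition stacked_pot (w x : nat) : nat :=
  if x == w then 0 else (cycle_dist w./2 x./2).+1 + ~~ odd x.

Lemma line_dist_step q i :
  line_dist q i.+1 <= (line_dist q i).+1 /\ line_dist q i <= (line_dist q i.+1).+1.
Proof. by rewrite /line_dist; lia. Qed.

Lemma cycle_distxx i : cycle_dist i i = 0.
Proof. by rewrite /cycle_dist line_distxx min0n. Qed.

Lemma cycle_dist_succ q i : q < L -> i.+1 < L ->
  cycle_dist q i.+1 <= (cycle_dist q i).+1 /\
  cycle_dist q i <= (cycle_dist q i.+1).+1.
Proof.
move=> qL iL; have [] := line_dist_step q i; rewrite /cycle_dist.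
have : line_dist q i < L by rewrite /line_dist; lia.
have : line_dist q i.+1 < L by rewrite /line_dist; lia.
by move: (line_dist _ _) (line_dist _ _) => a b; clear; lia.
Qed.

Lemma cycle_dist_wrap q : q < L ->
  cycle_dist q 0 <= (cycle_dist q L.-1).+1 /\
  cycle_dist q L.-1 <= (cycle_dist q 0).+1.
Proof.
move=> qL; have d0 : line_dist q 0 = q by rewrite /line_dist; lia.
have dL : line_dist q L.-1 = L.-1 - q by rewrite /line_dist; lia.
by rewrite /cycle_dist d0 dL; lia.
Qed.

Lemma folded_pot_lipschitz (w : 'I_L) : ~~ odd w -> w != 0 :> nat ->
  lipschitz (@folded L) (fun x => folded_pot w x).
Proof.
move=> we w0.
(* An edge is an arc in either direction, so each arc has to satisfy both inequalities. *)
suff arc (x y : 'I_L) : folded_arc x y ->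
    folded_pot w y <= (folded_pot w x).+1 /\
    folded_pot w x <= (folded_pot w y).+1.
  by move=> x y /orP[] /arc[].
have odd_neq n : odd n -> (n == w) = false.
  by move=> no; apply/negP=> /eqP nw; rewrite -nw no in we.
rewrite folded_arcE /folded_pot.
case/or3P=> /andP[xo /eqP ->]; have := line_dist_step (uphalf w) (uphalf x).
- by rewrite !odd_neq //= ?negbK ?xo /= ?addn0.
- have ux : uphalf x = x./2.+1 by rewrite uphalf_half xo.
  rewrite (odd_neq x) //= xo ux /= => _; case: eqP => [<-|_]; last first.
    by move: (line_dist _ _) => d; clear; lia.
  by rewrite /= line_distxx.
by rewrite (eqP xo) odd_neq // [0 == _]eq_sym (negPf w0) /= !addn0.
Qed.

Lemma stacked_pot_lipschitz (w : 'I_(2 * L)) : ~~ odd w ->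
  lipschitz (@stacked L) (fun x => stacked_pot w x).
Proof.
move=> we; have wL := ltn_ord w.
suff arc (x y : 'I_(2 * L)) : stacked_arc x y ->
    stacked_pot w y <= (stacked_pot w x).+1 /\
    stacked_pot w x <= (stacked_pot w y).+1.
  by move=> x y /orP[] /arc[].
have xL := ltn_ord x; have yL := ltn_ord y; rewrite stacked_arcE.
have odd_neq n : odd n -> (n == w) = false.
  by move=> no; apply/negP=> /eqP nw; rewrite -nw no in we.
rewrite /stacked_pot; case/or3P=> /andP[xo /eqP yE]; rewrite yE.
- rewrite (odd_neq x.+1) //= xo uphalf_half (negPf xo) add0n.
  case: eqP => [->|_]; first by rewrite cycle_distxx.
  by move: (cycle_dist _ _) => d; clear; lia.
- rewrite !odd_neq //= ?negbK // xo /= !addn0.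
  by apply: cycle_dist_succ; lia.
have xE : x./2 = L.-1 by lia.
have xo' : odd x by lia.
by rewrite !odd_neq //= xo' xE !addn0; apply: cycle_dist_wrap; lia.
Qed.

Lemma folded_pot_far (w : 'I_L) : ~~ odd w -> w != 0 :> nat ->
  exists x : 'I_L, L./2 + 3 <= 2 * folded_pot w x.
Proof.
move=> we w0; have wL := ltn_ord w.
have L0 : 0 < L by lia.
have L1 : L.-1 < L by lia.
(* A [w] above the middle is compared with vertex 0, where the potential is [w./2 + 1]; any other
   with the hanging vertex [L.-1], where it is [L./2 - w./2 + 2]. *)
case: (ltnP L./2 w) => wl; [exists (Ordinal L0)|exists (Ordinal L1)];
  by rewrite /folded_pot /line_dist /=; case: ifP; lia.
Qed.

Lemma folded_pot_diam : exists w x : 'I_L,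
  [/\ ~~ odd w, w != 0 :> nat & L./2 + 1 <= folded_pot w x].
Proof.
have wL : L.-1 < L by lia.
have xL : 0 < L by lia.
exists (Ordinal wL), (Ordinal xL); rewrite /folded_pot /=; split; [lia..|].
by rewrite /line_dist; case: ifP; lia.
Qed.

Lemma stacked_pot_far (w : 'I_(2 * L)) : ~~ odd w ->
  exists x : 'I_(2 * L), L./2 + 2 <= stacked_pot w x.
Proof.
(* The witness is an even vertex half-way round the cycle: its position differs from that of [w] by
   [L./2] in the first case and by [L./2 + 1] in the second. *)
move=> we; have wL := ltn_ord w; case: (ltnP w L) => wl.
  have xL : w + L.-1 < 2 * L by lia.
  by exists (Ordinal xL); rewrite /stacked_pot /cycle_dist /line_dist /=; case: ifP; lia.
have xL : w - L.+1 < 2 * L by lia.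
by exists (Ordinal xL); rewrite /stacked_pot /cycle_dist /line_dist /=; case: ifP; lia.
Qed.

End FoldedStacked.

(** * Components of Gamma, and the spine without attachment *)

Section Spine.
Variables h L : nat.
Hypotheses (L_odd : odd L) (L_ge3 : 3 <= L).
Local Notation V := (Gamma_vertex h L).
Local Notation s := (num_stacked h L).

Definition label (x : V) : option 'I_s :=
  if x is inr (c, _) then Some c else None.

Lemma Gamma_sym : symmetric (@Gamma h L).
Proof.
move=> [i|[c i]] [j|[d j]] //=; first exact: symmetrise_sym.
by rewrite eq_sym; congr andb; apply: symmetrise_sym.
Qed.

Lemma Gamma_label (x y : V) : Gamma x y -> label x = label y.
Proof. by case: x y => [i|[c i]] [j|[d j]] //= /andP[/eqP->]. Qed.

Lemma Gamma_within (x y : V) : label x = label y ->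
  within (@Gamma h L) (L./2.+1 + (label x != None)) x y.
Proof.
case: x y => [i|[c i]] [j|[d j]] //=.
  move=> _; rewrite addn0.
  exact: (within_homo (g := @inl _ ('I_s * 'I_(2 * L))%type)
                      (fun _ _ => id) (folded_within L_odd L_ge3 i j)).
case=> ->; rewrite addn1.
apply: (@within_homo _ _ _ _ (fun i => inr (d, i) : V)
                     _ _ _ _ (stacked_within L_odd L_ge3 i j)).
by move=> a b /= ->; rewrite eqxx.
Qed.

(** Stated for any [e] so as to cover both [Gamma] and a spine whose new edge stays inside a
    component. *)
Lemma connect_label (e : rel V) (x y : V) :
  (forall a b, e a b -> label a = label b) -> subrel (@Gamma h L) e ->
  connect e x y = (label x == label y).
Proof.
move=> elab sub; apply/idP/eqP => [/connectP[p + ->]|/Gamma_within/within_connect].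
  by elim: p x => //= z p IH x /andP[/elab-> /IH].
by apply: connect_sub => a b /sub/connect1.
Qed.

Lemma edge_attachmentE (u v : V) : edge_attachment u v = (label u != label v).
Proof. by rewrite /edge_attachment (connect_label _ _ Gamma_label). Qed.

Lemma label_surj : 0 < L -> label @: [set: V] = setT.
Proof.
move=> L0; have L20 : 0 < 2 * L by lia.
apply/setP=> c; rewrite inE; apply/imsetP.
by case: c => [c|]; [exists (inr (c, Ordinal L20))|exists (inl (Ordinal L0))].
Qed.

(* The distance from the floor vertex w within its own component, extended by 0
   so as to be 1-Lipschitz on the whole graph. *)
Definition pot (w x : V) : nat :=
  match w, x with
  | inl j, inl k => folded_pot j k
  | inr (c, j), inr (d, k) => if c == d then stacked_pot L j k else 0
  | _, _ => 0
  end.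

Lemma potxx (w : V) : pot w w = 0.
Proof.
by case: w => [j|[c j]] /=; rewrite /folded_pot /stacked_pot ?eqxx.
Qed.

Lemma pot_label (w x : V) : label x != label w -> pot w x = 0.
Proof.
case: w x => [j|[c j]] [k|[d k]] //= cd.
by case: (eqVneq c d) cd => // ->; rewrite eqxx.
Qed.

Lemma pot_lipschitz (w : V) : floor_vertex w -> lipschitz (@Gamma h L) (pot w).
Proof.
case: w => [j /andP[j0 jo]|[c j] jo] [k|[d k]] [l|[b l]] //=.
  exact: (folded_pot_lipschitz L_odd L_ge3).
case/andP=> /eqP <- kl; case: eqP => // _.
exact: (stacked_pot_lipschitz L_odd L_ge3).
Qed.

Lemma pot_far (w : V) : floor_vertex w ->
  exists2 x : V, label x = label w & L./2 + 3 <= 2 * pot w x.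
Proof.
case: w => [j /andP[j0 jo]|[c j] jo] /=.
  by have [x] := folded_pot_far L_odd L_ge3 jo j0; exists (inl x).
have [x px] := stacked_pot_far L_odd L_ge3 jo.
by exists (inr (c, x)) => //; rewrite eqxx; lia.
Qed.

Lemma pot_far_stacked (w : V) : floor_vertex w -> label w != None ->
  exists2 x : V, label x = label w & L./2 + 2 <= pot w x.
Proof.
case: w => [j|[c j] jo _] //=.
have [x px] := stacked_pot_far L_odd L_ge3 jo.
by exists (inr (c, x)) => //; rewrite eqxx.
Qed.

(** The bounds of [Gamma_within] are attained, from a floor vertex [w] so that [pot w] is
    1-Lipschitz. *)
Lemma pot_diam (c : option 'I_s) : exists w x : V,
  [/\ floor_vertex w, label w = c, label x = c
    & L./2.+1 + (c != None) <= pot w x].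
Proof.
case: c => [c|].
  have L20 : 0 < 2 * L by lia.
  have [x /= px] := stacked_pot_far (w := Ordinal L20) L_odd L_ge3 isT.
  by exists (inr (c, Ordinal L20)), (inr (c, x)); split; rewrite //= eqxx; lia.
have [w [x [wo w0 px]]] := folded_pot_diam L_odd L_ge3.
by exists (inl w), (inl x); split; rewrite //= ?w0 //; lia.
Qed.

Lemma spine_sym (u v : V) : symmetric (spine u v).
Proof. by move=> x y; rewrite /spine Gamma_sym symmetrise_sym. Qed.

Lemma mean_diam_spineC (u v : V) : mean_diam (spine u v) = mean_diam (spine v u).
Proof.
apply: eq_mean_diam => x y; rewrite /spine /symmetrise; congr orb.
by rewrite orbC andbC; congr orb; rewrite andbC.
Qed.

(** The components are those of [Gamma], and walks of [Gamma] survive, so every diameter is at most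
    the old bound. *)
Lemma spine_mean_diam_same (u v : V) : label u = label v ->
  (mean_diam (spine u v) <= (s * L./2.+2 + L./2.+1)%:R / s.+1%:R)%R.
Proof.
move=> uv.
have sub : subrel (@Gamma h L) (spine u v) by move=> x y; rewrite /spine => ->.
have lab (x y : V) : spine u v x y -> label x = label y.
  by case/or3P=> [/Gamma_label|/andP[/eqP-> /eqP->]|/andP[/eqP-> /eqP->]].
rewrite (mean_diam_label (lab := label)); last first.
  by move=> x y; rewrite (connect_label _ _ lab sub).
rewrite label_surj ?cardsT ?card_option ?card_ord; last by lia.
rewrite ler_pM2r ?invr_gt0 ?ltr0n // ler_nat.
have dle (c : option 'I_s) :
    diam (spine u v) [set x | label x == c] <= L./2.+1 + (c != None).
  apply: diam_leq => x y; rewrite !inE => /eqP xc /eqP yc.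
  rewrite -[c]xc; apply: (within_homo (g := id) sub).
  by apply: Gamma_within; rewrite xc yc.
rewrite (bigD1 None) //= addnC leq_add //; last first.
  by have := dle None; rewrite eqxx addn0.
have -> : s * L./2.+2 = \sum_(c in setT | c != None :> option 'I_s) L./2.+2.
  rewrite sum_nat_cond_const; congr (_ * _).
  have sE : #|predC1 (None : option 'I_s)| = s.
    by rewrite cardC1 card_option card_ord.
  by rewrite -[LHS]sE; apply: eq_card => c; rewrite !inE.
by apply: leq_sum => c /andP[_ c0]; apply: leq_trans (dle c) _; rewrite c0 addn1.
Qed.

(** * The spine with attachment *)

Section Attachment.
Variables u v : V.
Hypotheses (uF : floor_vertex u) (vF : floor_vertex v).
Hypotheses (uv : label u != label v) (vS : label v != None).

(** The component of [v] takes over the label of [u], so the value [label v] no longer occurs. *)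
Definition merged_label (x : V) : option 'I_s :=
  if label x == label v then label u else label x.

Lemma spine_connect (x y : V) :
  connect (spine u v) x y = (merged_label x == merged_label y).
Proof.
have lab a b : spine u v a b -> merged_label a = merged_label b.
  rewrite /merged_label.
  case/or3P=> [/Gamma_label->|/andP[/eqP-> /eqP->]|/andP[/eqP-> /eqP->]] //;
  by rewrite eqxx (negPf uv).
have gam a b : label a = label b -> connect (spine u v) a b.
  move=> ab; apply: (@connect_sub _ (@Gamma h L)).
    by move=> c d cd; apply: connect1; rewrite /spine cd.
  by rewrite (connect_label _ _ Gamma_label) // ab.
have cuv : connect (spine u v) u v.
  by apply: connect1; rewrite /spine /symmetrise !eqxx orbT.
have csym := sym_connect_sym (spine_sym u v).
apply/idP/eqP => [/connectP[p + ->]|].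
  by elim: p x => //= z p IH x /andP[/lab-> /IH].
(* Each vertex is joined to one whose old label is its merged label: itself, or [u] when it lies in
   the component of [v]. *)
have rep a : exists2 b, connect (spine u v) a b & label b = merged_label a.
  rewrite /merged_label; case: eqP => [av|_]; last by exists a.
  by exists u => //; rewrite csym; apply: connect_trans cuv (gam _ _ _).
have [a xa la] := rep x; have [b yb lb] := rep y => xy.
apply: connect_trans xa (connect_trans _ _); last by rewrite csym; apply: yb.
by apply: gam; rewrite la lb.
Qed.

Lemma merged_label_image : merged_label @: [set: V] = [set~ label v].
Proof.
apply/setP=> c; rewrite !inE; apply/imsetP/idP => [[x _ ->]|cv].
  by rewrite /merged_label; case: ifP => // /negbT.
have : c \in label @: [set: V] by rewrite label_surj ?inE //; lia.
by case/imsetP=> x _ cx; exists x; rewrite // /merged_label -cx (negPf cv).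
Qed.

(** Both [u] and [v] lie outside component [c], where [pot w] vanishes, so the new edge keeps it
    1-Lipschitz. *)
Lemma diam_unmerged (c : option 'I_s) : c != label v -> c != label u ->
  L./2.+1 + (c != None) <= diam (spine u v) [set x | merged_label x == c].
Proof.
move=> cv cu; have [w [x [wF wc xc far]]] := pot_diam c.
have wm : merged_label w = c by rewrite /merged_label wc (negPf cv).
have xm : merged_label x = c by rewrite /merged_label xc (negPf cv).
apply: leq_trans far _; rewrite -[leqRHS]add0n -(potxx w).
apply: lipschitz_diam; rewrite ?inE ?wm ?xm ?spine_connect ?wm ?xm //.
move=> a b /or3P[/(pot_lipschitz wF)//|/andP[_ /eqP->]|/andP[/eqP-> _]];
  by rewrite pot_label // wc eq_sym.
Qed.

Lemma diam_merged (x y : V) : label x = label u -> label y = label v ->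
  pot u x + (pot v y).+1
    <= diam (spine u v) [set x | merged_label x == label u].
Proof.
move=> xu yv.
(* Every walk from [x] to [y] crosses the bridge [u v]. On the side of [u] the truncated difference
   starts at 0 in [x] and reaches [pot u x] in [u]; the successor accounts for the bridge. *)
pose f z := if label z == label v then pot u x + (pot v z).+1
            else pot u x - pot u z.
have fx : f x = 0 by rewrite /f xu (negPf uv) subnn.
have <- : f y = pot u x + (pot v y).+1 by rewrite /f yv eqxx.
have xm : merged_label x = label u by rewrite /merged_label xu (negPf uv).
have ym : merged_label y = label u by rewrite /merged_label yv eqxx.
rewrite -[leqRHS]add0n -fx.
apply: lipschitz_diam; rewrite ?inE ?spine_connect ?xm ?ym //.
move=> a b /or3P[ab|/andP[/eqP-> /eqP->]|/andP[/eqP-> /eqP->]].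
- have := pot_lipschitz vF ab.
  have : pot u a <= (pot u b).+1 by apply: pot_lipschitz; rewrite // Gamma_sym.
  by rewrite /f (Gamma_label ab); case: ifP; lia.
- by rewrite /f eqxx (negPf uv) !potxx; lia.
by rewrite /f eqxx (negPf uv) !potxx; lia.
Qed.

(** The factor 2 clears the half in the folded eccentricity bound [(m + 3)/2], where [m = L./2]. *)
Lemma merged_diam_sum :
  2 * s.-1 * L./2.+2 + 3 * L./2 + 9
    <= 2 * \sum_(c in [set~ label v])
             diam (spine u v) [set x | merged_label x == c].
Proof.
have ncard (A : {set option 'I_s}) k : #|A| = k ->
    #|[pred c | c \notin A]| = s.+1 - k.
  move=> <-; have := cardsC A; rewrite card_option card_ord => <-.
  by rewrite addKn; apply: eq_card => c; rewrite !inE.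
rewrite (bigD1 (label u)) ?inE //= mulnDr.
have [y yv fy] := pot_far_stacked vF vS.
case uN: (label u == None).
  (* Attachment to the folded component: twice the merged diameter is at least
     [(m + 3) + 2(m + 2) + 2 = 3m + 9], and [s - 1] stacked components remain. *)
  have [x xu fx] := pot_far uF; have := diam_merged xu yv.
  set S := (X in _ + 2 * X); suff : s.-1 * L./2.+2 <= S.
    by move: (s.-1) (diam _ _) (S) => a b c; lia.
  rewrite /S {S}.
  apply: leq_trans (_ : \sum_(i in [set~ label v] | i != label u) L./2.+2 <= _).
    rewrite sum_nat_cond_const leq_mul2r; apply/orP; right.
    rewrite -subn1 -[s - 1]/(s.+1 - 2) -(ncard [set label u; label v]) ?cards2 ?uv //.
    apply: subset_leq_card; apply/subsetP => c; rewrite !inE negb_or.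
    by case/andP=> -> ->.
  apply: leq_sum => c; rewrite !inE => /andP[cv cu].
  by have := diam_unmerged cv cu; rewrite -(eqP uN) cu addn1.
(* Two stacked components merge to diameter at least [2m + 5], and the folded one adds [m + 1].
   Doubled, this exceeds the required [2(m + 2) + 3m + 9] by [m - 1], nonnegative since [L >= 3]. *)
have {}uN : label u != None by rewrite uN.
have [x xu fx] := pot_far_stacked uF uN; have := diam_merged xu yv.
rewrite (bigD1 None) /=; last by rewrite !inE ![None == _]eq_sym vS uN.
have := diam_unmerged (c := None); rewrite ![None == _]eq_sym => /(_ vS uN).
have c3 : #|[set label u; label v; None]| = 3.
  by rewrite setUC cardsU1 cards2 !inE ![None == _]eq_sym (negPf uN) (negPf vS) uv.
(* Three distinct labels among [s + 1] force two stacked components. *)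
have s2 : 2 <= s by have := max_card [set label u; label v; None];
  rewrite c3 card_option card_ord.
set S := (X in _ + 2 * (_ + X)); suff : (s - 2) * L./2.+2 <= S.
  have -> : s.-1 = (s - 2).+1 by lia.
  by move: (s - 2) (diam _ _) (diam _ _) (S) => a b c d; lia.
rewrite /S {S}.
apply: leq_trans (_ : \sum_(i | (i \in [set~ label v]) && (i != label u)
        && (i != None)) L./2.+2 <= _).
  rewrite sum_nat_cond_const leq_mul2r; apply/orP; right.
  rewrite -[s - 2]/(s.+1 - 3) -(ncard _ _ c3).
  apply: subset_leq_card; apply/subsetP => c; rewrite !inE !negb_or.
  by case/andP=> /andP[-> ->] ->.
apply: leq_sum => c; rewrite !inE => /andP[/andP[cv cu] c0].
by have := diam_unmerged cv cu; rewrite c0 addn1.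
Qed.
End Attachment.
End Spine.

Lemma spine_mean_diam_attached (h L : nat) (u v : Gamma_vertex h L) :
  odd L -> 3 <= L -> 0 < num_stacked h L -> floor_vertex u -> floor_vertex v ->
  label u != label v ->
  ((2 * (num_stacked h L).-1 * L./2.+2 + 3 * L./2 + 9)%:R
     / (2 * num_stacked h L)%:R <= mean_diam (spine u v))%R.
Proof.
move=> L_odd L_ge3 s_gt0.
(* Distinct labels are not both [None], and the spine is symmetric in [u] and [v]. *)
wlog vS : u v / label v != None => [wl uF vF uv|uF vF uv].
  case: (eqVneq (label v) None) => [vN|vS]; last exact: wl.
  by rewrite mean_diam_spineC wl // ?[label v == _]eq_sym // -vN.
rewrite (mean_diam_label (spine_connect L_odd L_ge3 uv)) merged_label_image //.
rewrite cardsC1 card_option card_ord /= natrM invfM mulrA.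
rewrite ler_pM2r ?invr_gt0 ?ltr0n // ler_pdivrMr ?ltr0n // -natrM ler_nat.
by rewrite [leqRHS]mulnC; apply: merged_diam_sum.
Qed.

Lemma odd_multiple_num_stacked (h L : nat) : odd h -> (L %| h) -> (L < h) ->
  h = L * (2 * num_stacked h L + 1) /\ 0 < num_stacked h L.
Proof.
rewrite /num_stacked => h_odd /dvdnP[k hk]; move: h_odd; rewrite hk oddM.
case/andP=> k_odd L_odd; have L_gt0 := odd_gt0 L_odd.
rewrite mulnK // -[X in X < _]mul1n ltn_pmul2r // mulnC => k_gt1.
by split; last lia; congr (_ * _); lia.
Qed.

(** * Arithmetic of the two bounds and conclusion *)

Local Open Scope ring_scope.

(** Here [h - L = 2LS], and a factor [L] cancels. *)
Lemma attached_boundE (R : realFieldType) (M S : R) : 0 <= M -> 1 <= S ->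
  let L := 2%:R * M + 1 in let h := L * (2%:R * S + 1) in
  (h * L + 3%:R * h + 6%:R * L) / (2%:R * (h - L))
    = (2%:R * (S - 1) * (M + 2%:R) + 3%:R * M + 9%:R) / (2%:R * S).
Proof.
(* The denominators become linear once [M * S] is an atom, so its sign lets [lra] see that they are
   nonzero. *)
move=> M_ge0 S_ge1 /=; have MS : 0 <= M * S by nra.
by field; apply/andP; split; lra.
Qed.

Lemma unattached_boundE (R : realFieldType) (M S : R) : 0 <= M -> 1 <= S ->
  let L := 2%:R * M + 1 in let h := L * (2%:R * S + 1) in
  1 / 2%:R * (L + 3%:R - 4%:R * L / (h + L))
    = (S * (M + 2%:R) + (M + 1)) / (S + 1).
Proof.
move=> M_ge0 S_ge1 /=; have MS : 0 <= M * S by nra.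
by field; apply/andP; split; lra.
Qed.

(** The two sides are [M + 2 - 1/(S + 1)] and [M + 2 + (M + 5)/(2S)]. *)
Lemma unattached_lt_attached (R : realFieldType) (M S : R) : 0 <= M -> 1 <= S ->
  (S * (M + 2%:R) + (M + 1)) / (S + 1)
    < (2%:R * (S - 1) * (M + 2%:R) + 3%:R * M + 9%:R) / (2%:R * S).
Proof.
move=> M_ge0 S_ge1; apply: (@lt_trans _ _ (M + 2%:R)).
  by rewrite ltr_pdivrMr; lra.
by rewrite ltr_pdivlMr; lra.
Qed.

Theorem mainTheorem15 (p h L : nat) (P : algC -> Prop)
  (p_prime : prime p)
  (p_mod120 : (p %% 120 = 71)%N \/ (p %% 120 = 119)%N)
  (h_def : class_number p h)
  (P_prime : prime_ideal p P)
  (P_above2 : P 2%:R)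
  (L_def : class_order p P L)
  (h_odd : odd h)
  (L_odd : odd L)
  (L_ge3 : (3 <= L)%N)
  (L_dvd_h : (L %| h)%N)
  (L_lt_h : (L < h)%N) :
  let lhs : rat :=
    (h%:R * L%:R + 3%:R * h%:R + 6%:R * L%:R) / (2%:R * (h%:R - L%:R)) in
  let rhs : rat :=
    1 / 2%:R * (L%:R + 3%:R - 4%:R * L%:R / (h%:R + L%:R)) in
  [/\ lhs > rhs,
      forall u v : Gamma_vertex h L, floor_pair u v ->
        (edge_attachment u v -> mean_diam (spine u v) >= lhs) /\
        (~~ edge_attachment u v -> mean_diam (spine u v) <= rhs)
    & forall u v u' v' : Gamma_vertex h L, floor_pair u v -> floor_pair u' v' ->
        mean_diam (spine u v) = mean_diam (spine u' v') ->
        edge_attachment u v = edge_attachment u' v'].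
Proof.
move=> lhs rhs.
have [hE s_gt0] := odd_multiple_num_stacked h_odd L_dvd_h L_lt_h.
pose s := num_stacked h L; pose m := L./2.
pose S : rat := s%:R; pose M : rat := m%:R.
have M_ge0 : 0 <= M by rewrite ler0n.
have LM : L%:R = 2%:R * M + 1 :> rat.
  by rewrite -natrM -[1]/(1%:R) -natrD; congr _%:R; rewrite /m; lia.
have hS : h%:R = (2%:R * M + 1) * (2%:R * S + 1) :> rat.
  by rewrite [in LHS]hE natrM LM natrD natrM.
have m1E : m.+1%:R = M + 1 :> rat by rewrite -natr1.
have m2E : m.+2%:R = M + 2%:R :> rat by rewrite -addn2 natrD.
have s1E : s.+1%:R = S + 1 :> rat by rewrite -natr1.
(* The truncated predecessor is a true difference because [s] is positive. *)
have pred_sE : s.-1%:R = S - 1 :> rat by rewrite -subn1 natrB.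
have S_ge1 : 1 <= S by rewrite ler1n.
have lhsE : lhs = (2 * s.-1 * m.+2 + 3 * m + 9)%:R / (2 * s)%:R.
  by rewrite /lhs hS LM attached_boundE // natrD natrD !natrM pred_sE m2E.
have rhsE : rhs = (s * m.+2 + m.+1)%:R / s.+1%:R.
  by rewrite /rhs hS LM unattached_boundE // natrD natrM m1E m2E s1E.
have rhs_lt_lhs : rhs < lhs.
  rewrite /lhs /rhs hS LM attached_boundE // unattached_boundE //.
  exact: unattached_lt_attached.
have mean_bounds (u v : Gamma_vertex h L) : floor_pair u v ->
    (edge_attachment u v -> lhs <= mean_diam (spine u v)) /\
    (~~ edge_attachment u v -> mean_diam (spine u v) <= rhs).
  case/and3P=> uF vF _; rewrite edge_attachmentE // negbK lhsE rhsE.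
  split=> [uv|/eqP uv]; first exact: spine_mean_diam_attached.
  exact: spine_mean_diam_same.
(* If just one of two pairs with equal means were attached, the common mean would give
   [lhs <= rhs]. *)
split=> // u v u' v' /mean_bounds[a b] /mean_bounds[a' b'] eq_mean.
move: a b a' b'; rewrite eq_mean.
case: (edge_attachment u v); case: (edge_attachment u' v') => // a b a' b'.
  by have := le_lt_trans (le_trans (a isT) (b' isT)) rhs_lt_lhs; rewrite ltxx.
by have := le_lt_trans (le_trans (a' isT) (b isT)) rhs_lt_lhs; rewrite ltxx.
Qed.
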